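(* Let $\mathcal{H}$ be the Hilbert space described in the context and let $\mu$ be a Borel probability measure on $\mathcal{H}$. Assume there are constants $C>0$ and $\gamma>1$ such that for all $d\ge1$, $$\mu\Big(\Big\{x:\sum_{j=d+1}^\infty \frac{1}{\lambda_j} \langle x,\psi_j\rangle_{L^2}^2 >0 \Big\}\Big)\leq Cd^{-\gamma}.$$ Let $X_1,\dots,X_n$ be i.i.d. with law $\mu$. Then for all $\epsilon>0$, $$\mathbb{P}\left(\sup_{(\theta,t)\in \mathcal{H} \times \mathbb{R}}\frac{|F_{\theta}(t)-F_{\theta,n}(t)|}{\sqrt{F_\theta(t)\vee F_{\theta,n}(t)}}\ge \epsilon \right)\le e^{C \log(2n+1)n^{\frac{1}{\gamma}} -\frac{c n\epsilon^2}{64}},$$ where $c>0$ is an absolute constant and $C>0$ depends on $\gamma$.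
   Context: Let $(\Omega,m)$ be a measure space, $(\psi_j)_{j\ge1}$ an orthonormal basis of $L^2(\Omega,m)$ with inner product $\langle\cdot,\cdot\rangle_{L^2}$, and $(\lambda_j)_{j\ge1}$ a non-increasing sequence of positive numbers converging to $0$. Let $\mathcal{H}=\{f\in L^2(\Omega,m):\sum_j\langle f,\psi_j\rangle_{L^2}^2/\lambda_j<\infty\}$ with inner product $\langle f,g\rangle_{\mathcal{H}}=\sum_j\lambda_j^{-1}\langle f,\psi_j\rangle_{L^2}\langle g,\psi_j\rangle_{L^2}$. For $\theta\in\mathcal{H}$ and $t\in\mathbb{R}$, $F_\theta(t)=\mu(\{x:\langle x,\theta\rangle_{\mathcal{H}}\le t\})$ and $F_{\theta,n}(t)=\mu_n(\{x:\langle x,\theta\rangle_{\mathcal{H}}\le t\})$, where $\mu_n=\frac1n\sum_{j=1}^n\delta_{X_j}$. *)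

(* Defs.v *)
From HB Require Import structures.
From mathcomp Require Import all_boot all_order all_algebra.
From mathcomp Require Import all_classical all_reals all_analysis.

Set Implicit Arguments.
Unset Strict Implicit.
Unset Printing Implicit Defensive.

Import Order.TTheory GRing.Theory Num.Theory.
Import numFieldNormedType.Exports.
Local Open Scope classical_set_scope.
Local Open Scope ring_scope.

Section L2.
Context {R : realType} {d : measure_display} {Om : measurableType d}
  (m : {measure set Om -> \bar R}).

Definition L2fun (f : Om -> R) : Prop :=
  measurable_fun setT f /\ m.-integrable setT (fun x => (f x ^+ 2)%:E).

Definition L2ip (f g : Om -> R) : R := \int[m]_(x in setT) (f x * g x).

Definition orthonormal_basis (psi : nat -> Om -> R) : Prop :=
  (forall j, L2fun (psi j)) /\
  (forall i j, L2ip (psi i) (psi j) = (i == j)%:R) /\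
  (forall f, L2fun f -> (forall j, L2ip f (psi j) = 0) ->
     {ae m, forall x, f x = 0}).

Variables (psi : nat -> Om -> R) (lam : nat -> R).

Definition inH (f : Om -> R) : Prop :=
  L2fun f /\ (\sum_(j <oo) ((L2ip f (psi j)) ^+ 2 / lam j)%:E < +oo)%E.

Lemma inH0 : inH (fun _ => 0).
Proof.
have ip0 j : L2ip (fun _ => 0) (psi j) = 0.
  rewrite /L2ip /Rintegral.
  under eq_integral do rewrite mul0r.
  by rewrite integral0.
split; last first.
  under eq_fun do under eq_bigr do rewrite ip0 expr0n /= mul0r.
  rewrite (_ : (fun _ => _) = fun=> 0%E); first by rewrite lim_cst ?ltry.
  by apply/funext => n; rewrite big1.
split; first exact: measurable_cst.
under eq_fun do rewrite expr0n /=.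
exact: integrable0.
Qed.

Record Hpt := MkH { Hval :> Om -> R ; HvalP : inH Hval }.

HB.instance Definition _ := gen_eqMixin Hpt.
HB.instance Definition _ := gen_choiceMixin Hpt.
HB.instance Definition _ := isPointed.Build Hpt (MkH inH0).

Definition coord (j : nat) (x : Hpt) : R := L2ip x (psi j).

(** generating class of the (Borel = cylinder) sigma-algebra of H *)
Definition coord_sets : set (set Hpt) :=
  [set coord j @^-1` B | j in [set: nat] & B in (measurable : set (set R))].

Definition Hspace := g_sigma_algebraType coord_sets.

Definition Hip (f g : Om -> R) : R :=
  limn (fun N => \sum_(j < N) (lam j)^-1 * L2ip f (psi j) * L2ip g (psi j)).

(** {x : sum_{j >= k} <x,psi_j>^2/lam_j > 0}  (0-indexed tail) *)
Definition tail_set (k : nat) : set Hspace :=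
  [set x : Hspace | (0 < \sum_(k <= j <oo) ((coord j x) ^+ 2 / lam j)%:E)%E].

Definition Fth (mu : probability Hspace R) (th : Hspace) (t : R) : R :=
  fine (mu [set x : Hspace | Hip x th <= t]).

Definition Fthn {T : Type} (n : nat) (X : 'I_n -> T -> Hspace)
  (th : Hspace) (t : R) (w : T) : R :=
  (\sum_(i < n) (((Hip (X i w) th <= t)%R)%:R : R)) / n%:R.

Definition ratio (mu : probability Hspace R) {T : Type} (n : nat)
  (X : 'I_n -> T -> Hspace) (th : Hspace) (t : R) (w : T) : R :=
  `|Fth mu th t - Fthn X th t w| / Num.sqrt (Num.max (Fth mu th t) (Fthn X th t w)).

Definition bad_event (mu : probability Hspace R) {T : Type} (n : nat)
  (X : 'I_n -> T -> Hspace) (eps : R) : set T :=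
  [set w | (eps%:E <= ereal_sup (range (fun p : Hspace * R =>
                                  (ratio mu X p.1 p.2 w)%:E)))%E].

End L2.

Section iid.
Context {R : realType} {dP dT : measure_display} {Om' : measurableType dP}
  {T : measurableType dT}.

Definition iid (P : probability Om' R) (n : nat) (X : 'I_n -> Om' -> T)
  (mu : probability T R) : Prop :=
  (forall i, measurable_fun setT (X i)) /\
  (forall i A, measurable A -> P (X i @^-1` A) = mu A) /\
  (forall A : 'I_n -> set T, (forall i, measurable (A i)) ->
     P (\bigcap_(i in [set: 'I_n]) (X i @^-1` A i)) =
     (\prod_(i < n) P (X i @^-1` A i))%E).

End iid.

Arguments tail_set {R d Om} m psi lam k _.

(* Main.v *)
Require Import Defs.
From HB Require Import structures.
From mathcomp Require Import all_boot all_order all_algebra.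
From mathcomp Require Import all_classical all_reals all_analysis.
From mathcomp Require Import measurable_realfun ring lra.
Import Order.TTheory GRing.Theory Num.Theory.
Import numFieldNormedType.Exports.
Local Open Scope classical_set_scope.
Local Open Scope ring_scope.

(* Vapnik-Chervonenkis symmetrisation.  If some half-space violates the relative
   deviation bound on the sample, then by Chebyshev it also separates the sample
   from an independent ghost sample with probability at least 1/2, so it suffices
   to bound the probability that some dichotomy of the 2n points is unbalanced
   between the two halves.  Swapping X_i and X'_i independently preserves the law
   of the 2n points, and a Chernoff bound shows that each dichotomy is unbalanced
   for only a fraction 2 exp(-kappa/8) of the swaps.

   What remains is the expected number of dichotomies.  A point outside the tail
   set with index k has only k nonzero coordinates, so a shattered set contains
   at most k+1 such points, and a configuration with N points in the tail has at
   most 2^N (2n+1)^(k+1) dichotomies.  With k close to n^(1/gamma) the tail has mass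
   at most C/n and the expectation of 2^N is at most exp(2C).

   No measurability issue arises for the supremum: on finitely many points every
   dichotomy is realised strictly by a half-space with finitely many rational
   coefficients and rational threshold. *)

Set Implicit Arguments.
Unset Strict Implicit.

(** * Shattering *)

Definition shatters (J : finType) (F : {set {set J}}) (A : {set J}) : bool :=
  [forall B : {set J}, (B \subset A) ==> [exists S in F, S :&: A == B]].

(* Split [F] along a point [x] and apply induction to the two traces on the
   remaining points: a set shattered by both traces yields a second shattered
   set after adding [x]. *)
Lemma card_le_shatters (J : finType) (F : {set {set J}}) :
  (#|F| <= #|[set A | shatters F A]%SET|)%N.
Proof.
suff main (n : nat) (D : {set J}) (G : {set {set J}}) : #|D| = n ->
    (forall S, S \in G -> S \subset D) ->
    (#|G| <= #|[set A : {set J} | (A \subset D) && shatters G A]%SET|)%N.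
  have h := main #|J| [set: J]%SET F (cardsT J) (fun S _ => finset.subsetT S).
  apply: (leq_trans h); apply: subset_leq_card; apply/fintype.subsetP => A.
  by rewrite !inE => /andP[].
elim: n D G => [|n IHn] D G.
  move/eqP; rewrite cards_eq0 => /eqP -> GD.
  have [->|[S0 S0G]] := set_0Vmem G; first by rewrite cards0.
  have -> : G = [set finset.set0]%SET.
    apply/setP => S; rewrite inE; apply/idP/eqP => [/GD|->].
      by rewrite finset.subset0 => /eqP.
    by move: S0G (S0G) => /GD; rewrite finset.subset0 => /eqP ->.
  rewrite cards1 card_gt0; apply/set0Pn; exists finset.set0.
  rewrite inE finset.sub0set /=; apply/forallP => B; apply/implyP.
  rewrite finset.subset0 => /eqP ->; apply/existsP; exists finset.set0.
  by rewrite inE eqxx /= finset.setI0.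
move=> cD GD.
have /set0Pn[x xD] : D != finset.set0 by rewrite -card_gt0 cD.
have cD' : #|D :\ x| = n by move: (finset.cardsD1 x D); rewrite xD cD => -[].
pose G0 := [set S in G | x \notin S]%SET.
pose G1 := [set S :\ x | S in [set S in G | x \in S]]%SET.
have cG : #|G| = (#|G0| + #|G1|)%N.
  have -> : #|G1| = #|[set S in G | x \in S]%SET|.
    apply: card_in_imset => S T; rewrite !inE => /andP[_ xS] /andP[_ xT] e.
    by rewrite -(finset.setD1K xS) -(finset.setD1K xT) e.
  rewrite -(finset.cardsID [set S : {set J} | x \in S]%SET G) addnC; congr (_ + _)%N.
    by apply: eq_card => S; rewrite !inE andbC.
  by apply: eq_card => S; rewrite !inE andbC.
have G0D S : S \in G0 -> S \subset D :\ x.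
  by rewrite inE => /andP[/GD SD xS]; rewrite finset.subsetD1 SD.
have G1D S : S \in G1 -> S \subset D :\ x.
  move=> /imsetP[T]; rewrite inE => /andP[/GD TD xT] ->.
  by apply: finset.setSD.
rewrite cG; apply: (leq_trans (leq_add (IHn _ _ cD' G0D) (IHn _ _ cD' G1D))).
set H0 := finset (fun A : {set J} => (A \subset D :\ x) && shatters G0 A).
set H1 := finset (fun A : {set J} => (A \subset D :\ x) && shatters G1 A).
have xH (A : {set J}) : A \subset D :\ x -> x \notin A.
  by rewrite finset.subsetD1 => /andP[].
have cI : #|[set x |: A | A in H0 :&: H1]%SET| = #|H0 :&: H1|.
  apply: card_in_imset => A B; rewrite !inE => /andP[/andP[/xH xA _] _].
  move=> /andP[/andP[/xH xB _] _] e.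
  by rewrite -(finset.setU1K xA) -(finset.setU1K xB) e.
(* [#|H0| + #|H1|] splits into union and intersection: the union embeds into the shattered sets
   avoiding [x], the intersection, with [x] added, into those containing [x]. *)
rewrite -finset.cardsUI -cI -[X in (_ <= X)%N](finset.cardsID [set A : {set J} | x \in A]%SET).
rewrite addnC; apply: leq_add; apply: subset_leq_card; apply/fintype.subsetP.
  move=> _ /imsetP[A + ->]; rewrite !inE => /andP[/andP[AD h0] /andP[_ h1]].
  have xA := xH _ AD.
  rewrite eqxx orTb andbT; apply/andP; split.
    rewrite finset.subUset finset.sub1set xD /=.
    by apply: (fintype.subset_trans AD); exact: finset.subsetDl.
  apply/forallP => B; apply/implyP => BA.
  have BxA : B :\ x \subset A by rewrite finset.subDset.
  have [xB|xB] := boolP (x \in B).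
    have /implyP/(_ BxA)/existsP[T /andP[]] := forallP h1 (B :\ x).
    move=> /imsetP[S]; rewrite inE => /andP[SG xS] -> /eqP e.
    apply/existsP; exists S; rewrite SG /=; apply/eqP.
    rewrite -(finset.setD1K xB) -e; apply/setP => y; rewrite !inE.
    by case: eqVneq => //= ->; rewrite xS.
  have /implyP/(_ BxA)/existsP[S /andP[]] := forallP h0 (B :\ x).
  rewrite inE => /andP[SG xS] /eqP e.
  apply/existsP; exists S; rewrite SG /=; apply/eqP.
  have -> : B = B :\ x.
    by apply/setP => y; rewrite !inE; case: eqVneq => //= ->; rewrite (negbTE xB).
  rewrite -e; apply/setP => y; rewrite !inE.
  by case: eqVneq => //= ->; rewrite (negbTE xS).
move=> A; rewrite !inE => h.
have AD : A \subset D :\ x by case/orP: h => /andP[].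
rewrite (xH _ AD) (fintype.subset_trans AD (finset.subsetDl _ _)) /=.
apply/forallP => B; apply/implyP => BA.
case/orP: h => /andP[_ /forallP/(_ B)/implyP/(_ BA)/existsP[S /andP[]]].
  by rewrite inE => /andP[SG _] e; apply/existsP; exists S; rewrite SG.
move=> /imsetP[T]; rewrite inE => /andP[TG _] -> /eqP <-.
apply/existsP; exists T; rewrite TG /=; apply/eqP/setP => y; rewrite !inE.
case: eqVneq => //= ->; by rewrite (negbTE (xH _ AD)) andbF.
Qed.

(** Each such set is the range of [K] slots, where a slot holds a point or [None]; there are
    [(#|J| + 1) ^ K] fillings. *)
Lemma card_small_subsets (J : finType) (K : nat) :
  (#|[set A : {set J} | #|A| <= K]%SET| <= (#|J| + 1) ^ K)%N.
Proof.
pose f (g : {ffun 'I_K -> option J}) : {set J} := [set y | Some y \in codom g]%SET.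
have -> : ((#|J| + 1) ^ K)%N = #|{ffun 'I_K -> option J}|.
  by rewrite card_ffun card_option card_ord addn1.
apply: (@leq_trans #|[set f g | g : {ffun 'I_K -> option J}]%SET|); last first.
  exact: leq_imset_card.
apply: subset_leq_card; apply/fintype.subsetP => A; rewrite inE => cA.
apply/imsetP; exists [ffun i : 'I_K => nth None (map Some (enum A)) i] => //.
apply/setP => y; rewrite inE; apply/idP/codomP => [yA|[i]].
  have iK : (index y (enum A) < K)%N.
    by apply: leq_trans cA; rewrite cardE index_mem mem_enum.
  exists (Ordinal iK); rewrite ffunE /= (nth_map y) ?nth_index //.
    by rewrite mem_enum.
  by rewrite index_mem mem_enum.
rewrite ffunE => e.
have [iA|iA] := ltnP i (size (enum A)); last first.
  by move: e; rewrite nth_default // size_map.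
by move: e; rewrite (nth_map y) // => -[->]; rewrite -mem_enum mem_nth.
Qed.

(* A linear dependency between more than [K] vectors of a [K]-dimensional space
   has a sign pattern that no linear functional can realise strictly. *)
Lemma linear_sign_patterns_card (R : realFieldType) (J : finType) (K : nat)
    (v : J -> 'rV[R]_K) (A : {set J}) :
  (forall B : {set J}, B \subset A -> exists u : 'cV[R]_K, forall p, p \in A ->
     (p \in B -> 0 < (v p *m u) 0 0) /\ (p \notin B -> (v p *m u) 0 0 < 0)) ->
  (#|A| <= K)%N.
Proof.
move=> hB; rewrite leqNgt; apply/negP => KA.
pose M : 'M[R]_(#|A|, K) := \matrix_(i < #|A|) v (enum_val i).
have rM : (\rank M < #|A|)%N by apply: leq_ltn_trans KA; exact: rank_leq_col.
have : kermx M != 0 by rewrite -mxrank_eq0 mxrank_ker -lt0n subn_gt0.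
move=> /rowV0Pn[c /sub_kermxP cM c0].
have [i0 ci0] : exists i, c 0 i != 0 by apply/rV0Pn.
(* With [B] the points of positive coefficient, every term of the dependency evaluated at [u] is
   nonnegative. The terms sum to zero, yet the one at [i0] is nonzero. *)
pose B := [set enum_val i | i : 'I_#|A| & 0 < c 0 i]%SET.
have BA : B \subset A by apply/fintype.subsetP => _ /imsetP[i _ ->]; exact: enum_valP.
have inB i : (enum_val i \in B) = (0 < c 0 i).
  apply/imsetP/idP => [[j + /enum_val_inj ->]|ci]; first by rewrite inE.
  by exists i; rewrite ?inE.
have [u hu] := hB B BA.
have /(congr1 (fun X : 'rV_1 => X 0 0)) : c *m M *m u = 0 by rewrite cM mul0mx.
rewrite -mulmxA !mxE.
have termE i : c 0 i * (M *m u) i 0 = c 0 i * (v (enum_val i) *m u) 0 0.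
  by rewrite !mxE; congr (_ * _); apply: eq_bigr => j _; rewrite mxE.
under eq_bigr do rewrite termE.
have term_ge0 i : 0 <= c 0 i * (v (enum_val i) *m u) 0 0.
  have [h1 h2] := hu _ (enum_valP i); have [c0i|c0i] := ltP 0 (c 0 i).
    by rewrite mulr_ge0 ?ltW// h1// inB.
  by rewrite mulr_le0// ltW// h2// inB -leNgt.
move=> /eqP; rewrite psumr_eq0 // => /allP/(_ i0 (mem_index_enum _)) /=.
rewrite mulf_eq0 (negbTE ci0) /=; have [h1 h2] := hu _ (enum_valP i0).
case: (boolP (enum_val i0 \in B)) => [/h1|/h2] h /eqP e; by rewrite e ltxx in h.
Qed.

(** * Random signs *)

(** The constant 2 in place of the sharp 1/2 allows an elementary proof: for [|x| > 1/2] both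
    exponents are at most [2 x^2], and for small [y] the bound [expR y <= 1 + y + 2 y^2] follows
    from [expR y * (1 - y) <= 1]. *)
Lemma expRDexpRN_le (R : realType) (x : R) :
  expR x + expR (- x) <= 2 * expR (2 * x ^+ 2).
Proof.
have E1 (y : R) : 1 / 2 < y -> expR y + expR (- y) <= 2 * expR (2 * y ^+ 2).
  move=> y2; rewrite mulr_natl mulr2n; apply: lerD; rewrite ler_expR; nra.
have [/E1//|x1] := ltP (1 / 2) x.
have [/E1|x2] := ltP (1 / 2) (- x); first by rewrite opprK sqrrN addrC.
have E2 (y : R) : `|y| <= 1 / 2 -> expR y <= 1 + y + 2 * y ^+ 2.
  rewrite ler_norml => /andP[y1 y2].
  have h : expR y * (1 - y) <= 1.
    rewrite -[leRHS](expRxMexpNx_1 y) ler_wpM2l ?expR_ge0 //.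
    exact: expR_ge1Dx.
  have : expR y * (1 - y) <= (1 + y + 2 * y ^+ 2) * (1 - y) by nra.
  by rewrite ler_pM2r //; lra.
have xh : `|x| <= 1 / 2 by rewrite ler_norml; lra.
have := E2 _ xh; have := E2 (- x); rewrite normrN sqrrN => /(_ xh).
have := expR_ge1Dx (2 * x ^+ 2); lra.
Qed.

(** This is the moment generating function of a Rademacher sum: the sum over sign vectors factors
    into a product over coordinates. *)
Lemma sum_signs_expR (R : realType) (n : nat) (a : 'I_n -> R) :
  \sum_(s : {ffun 'I_n -> bool}) expR (\sum_i (-1) ^+ s i * a i) <=
  2 ^+ n * expR (2 * \sum_i a i ^+ 2).
Proof.
under eq_bigr do rewrite expR_sum.
rewrite -(bigA_distr_bigA (fun i (b : bool) => expR ((-1) ^+ b * a i))) /=.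
rewrite mulr_sumr expR_sum -[in X in 2 ^+ X](card_ord n) -prodr_const -big_split /=.
apply: ler_prod => i _; rewrite big_bool /= expr0 expr1 mul1r mulN1r addrC.
by rewrite addr_ge0 ?expR_ge0 //= expRDexpRN_le.
Qed.

Lemma sum_signs_large (R : realType) (n : nat) (kappa : R) (a : 'I_n -> R) :
  0 <= kappa -> 0 < \sum_i a i ^+ 2 ->
  \sum_(s : {ffun 'I_n -> bool})
     (kappa * (\sum_i a i ^+ 2) <= (\sum_i (-1) ^+ s i * a i) ^+ 2)%R%:R <=
  2 ^+ n * (2 * expR (- kappa / 8)).
Proof.
set V := \sum_i a i ^+ 2 => k0 V0.
(* [l] minimises the Chernoff exponent [- l r + 2 l^2 V], with value [- kappa / 8]. Using both [l]
   and [- l] covers the two tails. *)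
pose r := Num.sqrt (kappa * V); pose l := r / (4 * V).
have r2 : r ^+ 2 = kappa * V by rewrite sqr_sqrtr // mulr_ge0 // ltW.
have r0 : 0 <= r by exact: sqrtr_ge0.
have l0 : 0 <= l by rewrite divr_ge0 // mulr_ge0 // ltW.
pose T (s : {ffun 'I_n -> bool}) (c : R) := \sum_i (-1) ^+ s i * (c * a i).
have TE (s : {ffun 'I_n -> bool}) c : T s c = c * \sum_i (-1) ^+ s i * a i.
  by rewrite mulr_sumr; apply: eq_bigr => i _; rewrite mulrCA.
have bound (s : {ffun 'I_n -> bool}) : (kappa * V <= (\sum_i (-1) ^+ s i * a i) ^+ 2)%R%:R <=
    expR (- (l * r)) * (expR (T s l) + expR (T s (- l))).
  rewrite !TE; set t := \sum_i (-1) ^+ s i * a i.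
  have [|_] := boolP (kappa * V <= t ^+ 2); last by rewrite mulr_ge0 ?addr_ge0 ?expR_ge0.
  rewrite -r2 => rt; have : r <= `|t| by rewrite -(@ler_pXn2r _ 2) ?nnegrE // real_normK ?num_real.
  rewrite mulrDr -!expRD.
  by case: (ger0P t) => t0 rt'; [apply: ler_wpDr|apply: ler_wpDl];
    rewrite ?expR_ge0 // -[leLHS]expR0 ler_expR; nra.
apply: (le_trans (ler_sum _ (fun s _ => bound s))).
rewrite -mulr_sumr big_split /=.
have key c : c ^+ 2 = l ^+ 2 ->
    \sum_s expR (T s c) <= 2 ^+ n * expR (2 * l ^+ 2 * V).
  move=> cl; apply: (le_trans (sum_signs_expR _)).
  have -> : \sum_i (c * a i) ^+ 2 = l ^+ 2 * V.
    by rewrite -cl mulr_sumr; apply: eq_bigr => i _; rewrite exprMn.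
  by rewrite mulrA.
have h := lerD (key l erefl) (key (- l) (sqrrN _)).
apply: (le_trans (ler_wpM2l (expR_ge0 _) h)).
have -> : - kappa / 8 = - (l * r) + 2 * l ^+ 2 * V.
  have -> : l * r = kappa / 4.
    by rewrite /l mulrAC -expr2 r2; field; exact: lt0r_neq0.
  rewrite /l exprMn r2; field; exact: lt0r_neq0.
rewrite expRD; lra.
Qed.

(** * Independent families *)

Lemma measurable_finforall {d} {T : measurableType d} {J : finType} (A : J -> set T) :
  (forall p, measurable (A p)) -> measurable [set w | forall p, A p w].
Proof.
move=> mA; have -> : [set w | forall p, A p w] = \bigcap_(p in [set: J]) A p.
  by apply/seteqP; split => w h p //; exact: h.
by apply: fin_bigcap_measurable => //; exact: finite_finset.
Qed.

(** The family is i.i.d. with law [mu], expressed on rectangles alone; they form a pi-system, so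
    this determines the joint law. *)
Definition rectangle_law {d dT} {Om : measurableType d} {T : measurableType dT}
    {R : realType} {J : finType} (Pr : probability Om R) (mu : probability T R)
    (Z : J -> Om -> T) : Prop :=
  (forall p, measurable_fun setT (Z p)) /\
  forall A : J -> set T, (forall p, measurable (A p)) ->
    Pr [set w | forall p, A p (Z p w)] = (\prod_p mu (A p))%E.

Definition rectangles (J : finType) {dT} (T : measurableType dT) : set (set (J -> T)) :=
  [set B | exists2 A : J -> set T, (forall p, measurable (A p)) &
     B = [set f | forall p, A p (f p)]].

Lemma measurable_family {d dT} {Om : measurableType d} {T : measurableType dT}
    {J : finType} (Z : J -> Om -> T) :
  (forall p, measurable_fun setT (Z p)) ->
  measurable_fun setT ((fun w p => Z p w) : Om -> g_sigma_algebraType (@rectangles J _ T)).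
Proof.
move=> mZ; apply: (@measurability _ _ _ (g_sigma_algebraType (@rectangles J _ T)) _ _
  (@rectangles J _ T)) => //.
move=> _ [_ [A mA ->] <-]; rewrite setTI.
apply: measurable_finforall => p; rewrite -[X in measurable X]setTI; exact: mZ.
Qed.

(** Rectangles are stable under intersection, so two push-forward laws that agree on them agree on
    the generated sigma-algebra. *)
Lemma rectangle_law_unique {d dT} {Om : measurableType d} {T : measurableType dT}
    {R : realType} {J : finType} (Pr : probability Om R) (mu : probability T R)
    (Z Z' : J -> Om -> T) (E : set (J -> T)) :
  rectangle_law Pr mu Z -> rectangle_law Pr mu Z' -> <<s @rectangles J _ T >> E ->
  Pr [set w | E (fun p => Z p w)] = Pr [set w | E (fun p => Z' p w)].
Proof.
move=> [mZ hZ] [mZ' hZ'] GE.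
set G := @rectangles J _ T in GE; pose V := g_sigma_algebraType G.
pose X : {mfun Om >-> V} := mfun_Sub (mem_set (measurable_family mZ)).
pose X' : {mfun Om >-> V} := mfun_Sub (mem_set (measurable_family mZ')).
have := @measure_unique _ R V G (fun=> setT) erefl _ _ _ (distribution Pr X)
  (distribution Pr X') _ _ E GE.
rewrite /distribution /pushforward /=; apply.
- move=> _ _ [A mA ->] [B mB ->]; exists (fun p => A p `&` B p).
    by move=> p; exact: measurableI.
  by apply/seteqP; split => [f [fA fB] p|f fAB]; [split|split => p; case: (fAB p)].
- by move=> _; exists (fun=> setT) => //; apply/seteqP; split.
- by rewrite bigcup_const.
- by move=> _ [A mA ->]; exact: (etrans (hZ A mA) (esym (hZ' A mA))).
- by move=> _; rewrite probability_setT ltry.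
Qed.

Lemma rectangle_law_reindex {d dT} {Om : measurableType d} {T : measurableType dT}
    {R : realType} {J : finType} (Pr : probability Om R) (mu : probability T R)
    (Z : J -> Om -> T) (s : J -> J) :
  bijective s -> rectangle_law Pr mu Z -> rectangle_law Pr mu (Z \o s).
Proof.
move=> [s' sK s'K] [mZ hZ]; split => [p|A mA]; first exact: mZ.
have -> : [set w | forall p, A p ((Z \o s) p w)] =
    [set w | forall p, A (s' p) (Z p w)].
  apply/seteqP; split => w h p /=; first by have := h (s' p); rewrite /= s'K.
  by have := h (s p); rewrite sK.
rewrite (hZ (A \o s')) //; last by move=> p; exact: mA.
by rewrite [RHS](reindex s') //; exists s => p _.
Qed.

(* On [Om * Om], index [(i, false)] reads the sample and [(i, true)] the ghost sample. *)
Definition ghost {Om T : Type} {n : nat} (X : 'I_n -> Om -> T)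
    (p : 'I_n * bool) (w : Om * Om) : T :=
  X p.1 (if p.2 then w.2 else w.1).

Lemma rectangle_law_ghost {d dT} {Om : measurableType d} {T : measurableType dT}
    {R : realType} {n : nat} (P : probability Om R) (mu : probability T R)
    (X : 'I_n -> Om -> T) :
  iid P X mu -> rectangle_law (P \x P)%E mu (ghost X).
Proof.
move=> [mX [lX indX]]; split => [[i b]|A mA].
  rewrite /ghost /=; case: b => /=.
    exact: (measurableT_comp (mX i) measurable_snd).
  exact: (measurableT_comp (mX i) measurable_fst).
pose B b := \bigcap_(i in [set: 'I_n]) (X i @^-1` A (i, b)).
have -> : [set w | forall p, A p (ghost X p w)] = B false `*` B true.
  apply/seteqP; split => [[w w'] h|[w w'] [/= h h'] [i []]].
  - by split => i _; [exact: (h (i, false))|exact: (h (i, true))].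
  - exact: h'.
  - exact: h.
have mB b : measurable (B b).
  apply: fin_bigcap_measurable => [|i _]; first exact: finite_finset.
  by rewrite -[X in measurable X]setTI; exact: mX.
have PB b : P (B b) = (\prod_(i < n) mu (A (i, b)))%E.
  rewrite (indX (fun i => A (i, b))) //; apply: eq_bigr => i _; exact: lX.
transitivity (P (B false) * P (B true))%E; first exact: product_measure1E.
rewrite !PB.
rewrite -big_split /=.
have -> : (\prod_p mu (A p) = \prod_(p : 'I_n * bool) mu (A (p.1, p.2)))%E.
  by apply: eq_bigr => -[].
rewrite -(pair_bigA _ (fun i b => mu (A (i, b)))) /=.
by apply: eq_bigr => i _; rewrite big_bool muleC.
Qed.

Lemma rectangle_law_iid {d dT} {Om : measurableType d} {T : measurableType dT}
    {R : realType} {n : nat} (P : probability Om R) (mu : probability T R)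
    (X : 'I_n -> Om -> T) :
  iid P X mu -> rectangle_law P mu X.
Proof.
move=> [mX [lX indX]]; split => // A mA.
have -> : [set w | forall p, A p (X p w)] = \bigcap_(i in [set: 'I_n]) (X i @^-1` A i).
  by apply/seteqP; split => w h i; [move=> _; exact: h|exact: (h i)].
by rewrite indX //; apply: eq_bigr => i _; exact: lX.
Qed.

(** Apply the law to the rectangle with side [A] on [U] and the whole space elsewhere. *)
Lemma rectangle_law_all {d dT} {Om : measurableType d} {T : measurableType dT}
    {R : realType} {J : finType} {Pr : probability Om R} {mu : probability T R}
    {Z : J -> Om -> T} (A : set T) (U : {set J}) :
  rectangle_law Pr mu Z -> measurable A ->
  measurable [set w | forall p, p \in U -> A (Z p w)] /\
  fine (Pr [set w | forall p, p \in U -> A (Z p w)]) = fine (mu A) ^+ #|U|.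
Proof.
move=> [mZ hZ] mA; pose B (p : J) : set T := if p \in U then A else setT.
have mB p : measurable (B p) by rewrite /B; case: ifP.
have -> : [set w | forall p, p \in U -> A (Z p w)] = [set w | forall p, B p (Z p w)].
  apply/seteqP; split => w /= h p; have := h p; rewrite /B; first by case: ifP => // pU; apply.
  by move=> + pU; rewrite pU.
split.
  apply: (measurable_finforall (A := fun p => Z p @^-1` B p)) => p.
  by rewrite -[X in measurable X]setTI; exact: mZ.
rewrite hZ // -prodr_const [RHS]big_mkcond /=; apply: EFin_inj.
rewrite fineK -?prodEFin.
  apply: eq_bigr => p _; rewrite /B; case: ifP => _; last by rewrite probability_setT.
  by rewrite fineK // fin_num_measure.
by apply: prode_fin_num => p _; exact: fin_num_measure.
Qed.

(** * Coordinates of the Hilbert space *)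

Section Hilbert.
Context {R : realType} {d : measure_display} {Om : measurableType d}
  (m : {measure set Om -> \bar R}) (psi : nat -> Om -> R) (lam : nat -> R).

Local Notation H := (Hspace m psi lam).
Local Notation crd j := (Defs.coord j : H -> R).

Lemma measurable_coord j : measurable_fun setT (crd j).
Proof.
move=> _ B mB; rewrite setTI; apply: sub_sigma_algebra.
by exists j => //; exists B.
Qed.

Lemma nneseries_lty_cvg (u : nat -> R) : (forall n, 0 <= u n) ->
  (\sum_(j <oo) (u j)%:E < +oo)%E -> cvgn (series u).
Proof.
move=> u0 uoo; apply: nondecreasing_is_cvgn.
  by apply/nondecreasing_series => n _.
have ufin : (\sum_(j <oo) (u j)%:E)%E \is a fin_num.
  by rewrite ge0_fin_numE // nneseries_ge0 // => n _ _; rewrite lee_fin.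
exists (fine (\sum_(j <oo) (u j)%:E)%E) => _ [N _ <-].
rewrite -lee_fin fineK // /series /= -sumEFin.
by apply: nneseries_lim_ge => i _ _; rewrite lee_fin.
Qed.

Hypothesis lam_gt0 : forall j, 0 < lam j.

(** [Hip] is a [limn], meaningful only when the partial sums converge. They converge absolutely
    because [|a b| <= a^2 + b^2] bounds the terms by the two convergent norm series. *)
Lemma cvg_Hip (x y : H) :
  \sum_(j < N) (lam j)^-1 * crd j x * crd j y @[N --> \oo] --> Hip m psi lam x y.
Proof.
pose u j := (lam j)^-1 * crd j x * crd j y.
suff cu : cvgn (series u).
  rewrite /Hip /Defs.coord /=.
  by move: cu; rewrite /series /=; under eq_fun do rewrite big_mkord; exact.
have cv (z : H) : cvgn (series (fun j => crd j z ^+ 2 / lam j)).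
  apply: nneseries_lty_cvg; last by case: (HvalP z).
  by move=> j; rewrite divr_ge0 ?sqr_ge0 ?ltW.
apply: normed_cvg.
have := is_cvg_seriesD (cv x) (cv y).
apply: series_le_cvg => j //=.
  by rewrite addr_ge0 // divr_ge0 ?sqr_ge0 ?ltW.
rewrite [leRHS](_ : _ = (lam j)^-1 * (crd j x ^+ 2 + crd j y ^+ 2)); last first.
  by rewrite -mulrDl mulrC.
rewrite /u -mulrA normrM gtr0_norm ?invr_gt0// ler_wpM2l ?invr_ge0 ?(ltW (lam_gt0 j)) // normrM.
rewrite -(real_normK (num_real (crd j x))) -(real_normK (num_real (crd j y))).
have amgm (a b : R) : 0 <= a -> 0 <= b -> a * b <= a ^+ 2 + b ^+ 2 by nra.
exact: amgm.
Qed.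

Lemma measurable_Hip (y : H) :
  measurable_fun setT (fun x : H => Hip m psi lam x y).
Proof.
apply: (@measurable_fun_cvg _ _ _ _ (fun N (x : H) =>
  \sum_(j < N) (lam j)^-1 * crd j x * crd j y)) => [N|x _]; last exact: cvg_Hip.
apply: measurable_sum => j; apply: measurable_funM => //.
by apply: measurable_funM => //; exact: measurable_coord.
Qed.

(** A series of nonnegative terms is positive exactly when one term is, so off the tail set all
    coordinates from [k] on vanish. *)
Lemma tail_setE k : tail_set m psi lam k =
  \bigcup_(j in [set j | (k <= j)%N]) [set x : H | crd j x != 0].
Proof.
have t0 (x : H) j : 0 <= crd j x ^+ 2 / lam j by rewrite divr_ge0 ?sqr_ge0 ?ltW.
apply/seteqP; split => x /=.
  apply: contraPP => h; apply/negP; rewrite -leNgt.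
  rewrite eseries0 // => j kj _; have [->|xj] := eqVneq (crd j x) 0.
    by rewrite expr0n mul0r.
  by exfalso; apply: h; exists j.
move=> [j /= kj xj].
apply: (@lt_le_trans _ _ (\sum_(k <= i < j.+1) (crd i x ^+ 2 / lam i)%:E)%E).
  rewrite sumEFin lte_fin big_nat_recr //=.
  by rewrite ltr_wpDl ?sumr_ge0// divr_gt0 // exprn_even_gt0.
by apply: nneseries_lim_ge => i _ _; rewrite lee_fin.
Qed.

Lemma measurable_tail_set k : measurable (tail_set m psi lam k).
Proof.
rewrite tail_setE; apply: bigcup_measurable => j _.
have -> : [set x : H | crd j x != 0] = crd j @^-1` [set~ 0].
  by apply/seteqP; split => x /= /eqP.
rewrite -[X in measurable X]setTI; apply: measurable_coord => //.
exact: measurableC.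
Qed.

(** Finite rational coefficient lists form a countable family, so unions over all of them stay
    measurable. *)
Definition rat_form (q : seq rat) (x : H) : R :=
  \sum_(j < size q) ratr q`_j * crd j x.

Lemma measurable_rat_form q : measurable_fun setT (rat_form q).
Proof.
apply: measurable_sum => j; apply: measurable_funM => //; exact: measurable_coord.
Qed.

Lemma rat_form_notin_tail k q (x : H) : ~ tail_set m psi lam k x ->
  rat_form q x = \sum_(j < k) ratr q`_j * crd j x.
Proof.
rewrite tail_setE => nx.
have x0 j : (k <= j)%N -> crd j x = 0.
  by move=> kj; apply/eqP/negPn/negP => xj; apply: nx; exists j.
have aux (f : nat -> R) a b : (a <= b)%N -> (forall j, (a <= j)%N -> f j = 0) ->
    \sum_(j < b) f j = \sum_(j < a) f j.
  move=> ab f0; rewrite -(subnKC ab) big_split_ord /= [X in _ + X]big1 ?addr0//.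
  by move=> j _; rewrite f0 // leq_addr.
pose f j := ratr q`_j * crd j x.
(* Both sums extend to this common length: past [size q] the default coefficient is 0, past [k] the
   coordinate is 0. *)
transitivity (\sum_(j < maxn (size q) k) f j).
  apply/esym/aux; rewrite ?leq_maxl // => j qj.
  by rewrite /f nth_default // rmorph0 mul0r.
by apply: aux; rewrite ?leq_maxr // => j kj; rewrite /f x0 // mulr0.
Qed.
End Hilbert.

(** * Rational half-spaces realising a given dichotomy *)

Lemma finite_gap (R : realType) (J : finType) (v : J -> R) (t : R) :
  exists t' : rat, forall p, (v p <= t -> v p < ratr t') /\ (t < v p -> ratr t' < v p).
Proof.
(* [g] is at most the next value above [t]; the default [t + 1] serves when there is none. A
   rational between [t] and [g] makes the weak inequality strict. *)
pose g := \big[Order.min/t + 1]_(p | t < v p) v p.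
have tg : t < g.
  by rewrite /g; elim/big_ind: _ => [|x y|//]; [rewrite ltrDl|rewrite lt_min => -> ->].
have [t' /[!in_itv]/= /andP[tt' t'g]] := rat_in_itvoo tg.
exists t' => p; split => [vt|tv]; first exact: le_lt_trans tt'.
apply: (lt_le_trans t'g); rewrite /g (bigD1 p) //= ge_min lexx //.
Qed.

Lemma rat_coef_approx (R : realType) (J : finType) (c : J -> nat -> R)
    (v : nat -> R) (N : nat) (t : R) :
  (forall p, \sum_(j < N) v j * c p j != t) ->
  exists q : seq rat, forall p,
    (\sum_(j < N) v j * c p j < t -> \sum_(j < size q) ratr q`_j * c p j < t) /\
    (t < \sum_(j < N) v j * c p j -> t < \sum_(j < size q) ratr q`_j * c p j).
Proof.
move=> vt; pose g := \big[Order.min/1]_p `|\sum_(j < N) v j * c p j - t|.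
have g0 : 0 < g.
  rewrite /g; elim/big_ind: _ => [//|x y|p _]; first by rewrite lt_min => -> ->.
  by rewrite normr_gt0 subr_eq0.
(* Coefficient errors below [g / S] move every sum by less than [g], a lower bound on its distance
   to [t]; the summand 1 keeps [S] positive. *)
pose S := 1 + \sum_p \sum_(j < N) `|c p j|.
have sumc0 p : 0 <= \sum_(j < N) `|c p j| by apply: sumr_ge0.
have S0 : 0 < S by rewrite ltr_wpDr ?sumr_ge0.
have d0 : 0 < g / S by rewrite divr_gt0.
have /choice[f hf] : forall j, exists q : rat, `|ratr q - v j| < g / S.
  move=> j; have vj : v j < v j + g / S by rewrite ltrDl.
  have [q /[!in_itv]/= /andP[q1 q2]] := rat_in_itvoo vj.
  by exists q; rewrite ltr_norml; lra.
exists (mkseq f N) => p; rewrite size_mkseq.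
have -> : \sum_(j < N) ratr (mkseq f N)`_j * c p j = \sum_(j < N) ratr (f j) * c p j.
  by apply: eq_bigr => j _; rewrite nth_mkseq.
have close : `|\sum_(j < N) ratr (f j) * c p j - \sum_(j < N) v j * c p j| < g.
  rewrite -sumrB; apply: (le_lt_trans (ler_norm_sum _ _ _)).
  apply: (@le_lt_trans _ _ (g / S * \sum_(j < N) `|c p j|)).
    rewrite mulr_sumr; apply: ler_sum => j _.
    by rewrite -mulrBl normrM ler_wpM2r // ltW.
  rewrite -mulrA gtr_pMr // mulrC ltr_pdivrMr // mul1r /S.
  rewrite (bigD1 p) //=; set A := \sum_(j < N) _; set B := \sum_(i | _) _.
  have : 0 <= B by apply: sumr_ge0. lra.
have gp : g <= `|\sum_(j < N) v j * c p j - t| by rewrite /g (bigD1 p) //= ge_min lexx.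
move: close gp; set a := \sum_(j < N) _; set b := \sum_(j < N) _.
by rewrite ltr_norml => /andP[h1 h2] gp; split => bt; move: gp;
  [rewrite ltr0_norm|rewrite gtr0_norm]; lra.
Qed.

(** Three perturbations preserve the dichotomy of finitely many points: a rational threshold that no
    point meets, truncation of the series of the inner product, and rational coefficients. *)
Lemma rat_dichotomy {R : realType} {d : measure_display} {Om : measurableType d}
    {m : {measure set Om -> \bar R}} {psi : nat -> Om -> R} {lam : nat -> R}
    (lam_gt0 : forall j, 0 < lam j) {J : finType} (x : J -> Hspace m psi lam)
    (th : Hspace m psi lam) (t : R) :
  exists qt : seq rat * rat, forall p,
    (Hip m psi lam (x p) th <= t -> rat_form qt.1 (x p) < ratr qt.2) /\
    (t < Hip m psi lam (x p) th -> ratr qt.2 < rat_form qt.1 (x p)).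
Proof.
have [t' ht'] := finite_gap (fun p => Hip m psi lam (x p) th) t.
pose s p N : R := \sum_(j < N) (lam j)^-1 * Defs.coord j th * Defs.coord j (x p).
have cs p : s p N @[N --> \oo] --> Hip m psi lam (x p) th.
  have := @cvg_Hip _ _ _ m psi lam lam_gt0 (x p) th; rewrite /s.
  by under eq_fun do under eq_bigr do rewrite mulrAC.
have /= [N _ /(_ N (leqnn N)) hN] : \forall N \near \oo, forall p,
    (Hip m psi lam (x p) th < ratr t' -> s p N < ratr t') /\
    (ratr t' < Hip m psi lam (x p) th -> ratr t' < s p N).
  apply: filter_forall => p.
  have [h|h|h] := ltgtP (Hip m psi lam (x p) th) (ratr t').
  - near=> N; split => // _; near: N; exact: (cvgr_lt _ (cs p)).
  - near=> N; split => // _; near: N; exact: (cvgr_gt _ (cs p)).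
  - by near=> N; split.
have ne p : s p N != ratr t'.
  have [h1 h2] := ht' p; have [g1 g2] := hN p.
  by case: (leP (Hip m psi lam (x p) th) t) => [/h1/g1 h|/h2/g2 h]; [rewrite lt_eqF|rewrite gt_eqF].
have [q hq] := @rat_coef_approx R J (fun p j => Defs.coord j (x p))
  (fun j => (lam j)^-1 * Defs.coord j th) N (ratr t') ne.
exists (q, t') => p /=; have [h1 h2] := ht' p; have [g1 g2] := hN p.
have [k1 k2] := hq p; split => h; [exact: k1 (g1 (h1 h))|exact: k2 (g2 (h2 h))].
Unshelve. all: by end_near. Qed.

(** * Swapping sample and ghost sample *)

Definition swap {n : nat} (s : {ffun 'I_n -> bool}) (p : 'I_n * bool) :
  'I_n * bool := (p.1, p.2 (+) s p.1).

Lemma swapK {n : nat} (s : {ffun 'I_n -> bool}) : involutive (swap s).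
Proof. by case=> i b; rewrite /swap /= -addbA addbb addbF. Qed.

Definition swap_set {n : nat} (s : {ffun 'I_n -> bool}) (S : {set 'I_n * bool}) :
  {set 'I_n * bool} := finset (fun p => swap s p \in S).

Lemma swap_setK {n : nat} (s : {ffun 'I_n -> bool}) : involutive (swap_set s).
Proof. by move=> S; apply/setP => p; rewrite !inE swapK. Qed.

Definition imbalance {R : realType} {n : nat} (S : {set 'I_n * bool}) (i : 'I_n) : R :=
  ((i, true) \in S)%:R - ((i, false) \in S)%:R.

(** The sum of squares counts the pairs that [S] splits, and is the variance of the randomly signed
    sum. The first conjunct excludes the trivial case [0 <= 0]. *)
Definition unbalanced {R : realType} {n : nat} (kappa : R) (S : {set 'I_n * bool}) :=
  (0 < \sum_i (imbalance S i : R) ^+ 2) &&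
  (kappa * (\sum_i imbalance S i ^+ 2) <= (\sum_i imbalance S i) ^+ 2).

Lemma imbalance_swap {R : realType} {n : nat} (s : {ffun 'I_n -> bool})
    (S : {set 'I_n * bool}) (i : 'I_n) :
  imbalance (swap_set s S) i = (-1) ^+ s i * imbalance S i :> R.
Proof.
rewrite /imbalance !inE /swap /=; case: (s i) => /=.
  by rewrite expr1 mulN1r opprB.
by rewrite expr0 mul1r.
Qed.

(** A swap changes only the signs of the imbalances and keeps their squares, so the Chernoff bound
    for random signs applies. *)
Lemma sum_unbalanced_swap {R : realType} {n : nat} (kappa : R) (S : {set 'I_n * bool}) :
  0 <= kappa ->
  \sum_(s : {ffun 'I_n -> bool}) (unbalanced kappa (swap_set s S))%:R <=
  2 ^+ n * (2 * expR (- kappa / 8)).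
Proof.
move=> k0; have sqE s : \sum_i (imbalance (swap_set s S) i : R) ^+ 2 =
    \sum_i imbalance S i ^+ 2.
  by apply: eq_bigr => i _; rewrite imbalance_swap exprMn sqrr_sign mul1r.
have [V0|V0] := ltP 0 (\sum_i (imbalance S i : R) ^+ 2); last first.
  rewrite big1 => [|s _]; first by rewrite !mulr_ge0 ?exprn_ge0 ?expR_ge0.
  by rewrite /unbalanced sqE ltNge V0.
apply: le_trans (sum_signs_large k0 V0); apply: ler_sum => s _.
rewrite /unbalanced sqE V0 /=.
by under [in X in X ^+ 2]eq_bigr do rewrite imbalance_swap.
Qed.

(* Averaging over the swaps: a swap-invariant weight gives unbalanced sets only
   the fraction of swaps that make a given set unbalanced. *)
Lemma sum_unbalanced_le {R : realType} {n : nat} (kappa : R)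
    (f : {set 'I_n * bool} -> R) :
  0 <= kappa -> (forall S, 0 <= f S) -> (forall s S, f (swap_set s S) = f S) ->
  \sum_(S | unbalanced kappa S) f S <= 2 * expR (- kappa / 8) * \sum_S f S.
Proof.
move=> k0 f0 fs.
rewrite -(@ler_pM2l _ (2 ^+ n)) ?exprn_gt0 // [leRHS]mulrA [leRHS]mulr_sumr.
have -> : 2 ^+ n * \sum_(S | unbalanced kappa S) f S =
    \sum_S \sum_(s : {ffun 'I_n -> bool}) (unbalanced kappa (swap_set s S))%:R * f S.
  rewrite exchange_big /=.
  rewrite [RHS](eq_bigr (fun=> \sum_(S | unbalanced kappa S) f S)).
    by rewrite sumr_const card_ffun card_bool card_ord -[RHS]mulr_natl natrX.
  move=> s _; rewrite (reindex (swap_set s)) /=; last first.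
    by exists (swap_set s) => S _; exact: swap_setK.
  rewrite [RHS]big_mkcond /=; apply: eq_bigr => S _.
  by rewrite swap_setK fs; case: unbalanced; rewrite ?mul1r ?mul0r.
apply: ler_sum => S _; rewrite -mulr_suml ler_wpM2r //.
exact: sum_unbalanced_swap.
Qed.

(** Integrate the pointwise inequality. This one form serves the union bound, the expected number of
    dichotomies and the variance computation. *)
Lemma sum_measure_le {d} {Om : measurableType d} {R : realType}
    (Pr : probability Om R) (I K : finType) (a : I -> R) (b : K -> R)
    (A : I -> set Om) (B : K -> set Om) :
  (forall i, 0 <= a i) -> (forall k, 0 <= b k) ->
  (forall i, measurable (A i)) -> (forall k, measurable (B k)) ->
  (forall w, \sum_i a i * \1_(A i) w <= \sum_k b k * \1_(B k) w) ->
  \sum_i a i * fine (Pr (A i)) <= \sum_k b k * fine (Pr (B k)).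
Proof.
move=> a0 b0 mA mB h.
have m1 (L : finType) (c : L -> R) (F : L -> set Om) : (forall i, measurable (F i)) ->
    forall i, measurable_fun setT (fun x => (c i * \1_(F i) x)%:E : \bar R).
  move=> mF i; apply/measurable_EFinP; apply: measurable_funM.
    exact: measurable_cst.
  exact: measurable_indic.
have ge0 (L : finType) (c : L -> R) (F : L -> set Om) : (forall i, 0 <= c i) ->
    forall i x, [set: Om] x -> (0 <= (c i * \1_(F i) x)%:E)%E.
  by move=> c0 i x _; rewrite lee_fin mulr_ge0.
have sumE (L : finType) (c : L -> R) (F : L -> set Om) :
    (forall i, 0 <= c i) -> (forall i, measurable (F i)) ->
    (\int[Pr]_x (\sum_i (c i * \1_(F i) x)%:E) = (\sum_i c i * fine (Pr (F i)))%:E)%E.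
  move=> c0 mF.
  rewrite (ge0_integral_sum _ measurableT (m1 _ _ _ mF) (ge0 _ _ _ c0)).
  rewrite -sumEFin; apply: eq_bigr => i _.
  under eq_integral do rewrite EFinM.
  rewrite ge0_integralZl_EFin //; last first.
    by apply/measurable_EFinP; exact: measurable_indic.
  by rewrite integral_indic // setIT EFinM fineK // fin_num_measure.
rewrite -lee_fin -!sumE //.
apply: ge0_le_integral => //.
- by move=> x _; apply: sume_ge0 => i _; exact: ge0.
- by apply: emeasurable_sum => i; exact: m1.
- by apply: emeasurable_sum => i; exact: m1.
- by move=> x _; rewrite !sumEFin lee_fin.
Qed.

(** * Dichotomies by half-spaces *)

Section Separation.
Context {R : realType} {d : measure_display} {Om : measurableType d}
  (m : {measure set Om -> \bar R}) (psi : nat -> Om -> R) (lam : nat -> R).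
Hypothesis lam_gt0 : forall j, 0 < lam j.

Local Notation H := (Hspace m psi lam).

(** Rational data make this a countable union of rectangles; strictness on both sides is what the
    linear sign-pattern bound needs. *)
Definition separated {J : finType} (S : {set J}) : set (J -> H) :=
  [set f | exists qt : seq rat * rat, forall p,
     (p \in S -> rat_form qt.1 (f p) < ratr qt.2) /\
     (p \notin S -> ratr qt.2 < rat_form qt.1 (f p))].

Lemma separated_cylinder {J : finType} (S : {set J}) :
  <<s @rectangles J _ H >> (separated S).
Proof.
set G := @rectangles J _ H.
pose A (qt : seq rat * rat) (p : J) : set H :=
  [set x | (p \in S -> rat_form qt.1 x < ratr qt.2) /\
           (p \notin S -> ratr qt.2 < rat_form qt.1 x)].
have -> : separated S = \bigcup_qt [set f | forall p, A qt p (f p)].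
  by apply/seteqP; split => f [qt]; [exists qt|move=> _; exists qt].
apply: (@countable_bigcupT_measurable _ (g_sigma_algebraType G)) => // qt.
apply: sub_sigma_algebra; exists (A qt) => // p.
have mq := measurable_rat_form (m := m) (psi := psi) (lam := lam) qt.1.
have [pS|pS] := boolP (p \in S).
  have -> : A qt p = rat_form qt.1 @^-1` `]-oo, ratr qt.2[.
    apply/seteqP; split => x; rewrite /A /= in_itv /= pS; first by case=> /(_ isT).
    by split.
  by rewrite -[X in measurable X]setTI; apply: mq => //; exact: measurable_itv.
have -> : A qt p = rat_form qt.1 @^-1` `]ratr qt.2, +oo[.
  apply/seteqP; split => x; rewrite /A /= in_itv /= andbT pS; first by case=> _ /(_ isT).
  by rewrite (negbTE pS); split.
by rewrite -[X in measurable X]setTI; apply: mq => //; exact: measurable_itv.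
Qed.

Lemma measurable_separated {d'} {Om' : measurableType d'} {J : finType}
    (Z : J -> Om' -> H) (S : {set J}) :
  (forall p, measurable_fun setT (Z p)) ->
  measurable [set w | separated S (fun p => Z p w)].
Proof.
move=> mZ; rewrite -[X in measurable X]setTI.
exact: (measurable_family mZ measurableT (separated_cylinder S)).
Qed.

(** Off the tail, affine half-spaces act on [k] coordinates; appending the constant coordinate [-1]
    makes them linear in dimension [k + 1]. *)
Lemma separated_shatters {J : finType} (k : nat) (f : J -> H) (A : {set J}) :
  (forall p, p \in A -> ~ tail_set m psi lam k (f p)) ->
  (forall B : {set J}, B \subset A -> exists2 S, separated S f & S :&: A = B)%SET ->
  (#|A| <= k.+1)%N.
Proof.
move=> nt sh.
pose v p : 'rV[R]_(k + 1) := row_mx (\row_j Defs.coord j (f p)) (-1)%:M.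
rewrite -addn1; apply: (linear_sign_patterns_card (v := v)) => B BA.
have [S [[q t] /= hS] SA] := sh B BA.
exists (col_mx (\col_(j < k) - ratr q`_j) (- ratr t)%:M) => p pA.
have -> : (v p *m col_mx (\col_(j < k) - ratr q`_j) (- ratr t)%:M) 0 0 =
    ratr t - rat_form q (f p).
  rewrite mul_row_col -scalar_mxM !mxE mulN1r opprK addrC mulr1n.
  rewrite (rat_form_notin_tail lam_gt0 q (nt p pA)) -sumrN; congr (_ + _).
  by apply: eq_bigr => j _; rewrite !mxE mulrN mulrC.
have <- : (p \in S) = (p \in B) by rewrite -SA inE pA andbT.
by have [h1 h2] := hS p; rewrite subr_gt0 subr_lt0.
Qed.

(** The sum over [U] equals [2 ^ N], with [N] the number of points in the tail; written this way,
    its expectation factors by independence. *)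
Lemma sum_separated_le {J : finType} (k : nat) (f : J -> H) :
  \sum_(S : {set J}) \1_(separated S) f <=
  ((#|J| + 1) ^ k.+1)%:R *
    \sum_(U : {set J}) \1_[set g : J -> H | forall p, p \in U -> tail_set m psi lam k (g p)] f :> R.
Proof.
pose T : {set J} := finset (fun p => `[< tail_set m psi lam k (f p) >]).
pose F : {set {set J}} := finset (fun S => `[< separated S f >]).
have -> : \sum_(S : {set J}) \1_(separated S) f = #|F|%:R :> R.
  rewrite -sum1_card natr_sum [RHS]big_mkcond /=; apply: eq_bigr => S _.
  by rewrite inE indicE; case: asboolP => h; [rewrite mem_set|rewrite memNset].
have -> : \sum_(U : {set J}) \1_[set g : J -> H |
    forall p, p \in U -> tail_set m psi lam k (g p)] f = #|powerset T|%:R :> R.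
  rewrite -sum1_card natr_sum [RHS]big_mkcond /=; apply: eq_bigr => U _.
  rewrite powersetE indicE; case: ifP => UT.
    rewrite mem_set //= => p pU.
    by have := fintype.subsetP UT p pU; rewrite inE => /asboolP.
  rewrite memNset //= => h; move/negP: UT; apply; apply/fintype.subsetP => p pU.
  by rewrite inE; apply/asboolP; exact: h.
rewrite -natrM ler_nat; apply: (leq_trans (card_le_shatters F)).
apply: (leq_trans (n := #|finset.setX [set A : {set J} | (#|A| <= k.+1)%N]%SET (powerset T)|)).
  (* A shattered set is coded by its part outside the tail, of size at most [k + 1], and an
     arbitrary subset of the tail points. *)
  pose g (A : {set J}) := (A :\: T, A :&: T)%SET.
  have ginj : injective g.
    by move=> A B [h1 h2]; rewrite -(finset.setID A T) -(finset.setID B T) h1 h2.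
  rewrite -(card_imset _ ginj); apply: subset_leq_card; apply/fintype.subsetP.
  move=> _ /imsetP[A + ->]; rewrite inE => /forallP sh.
  rewrite inE /= powersetE finset.subsetIr andbT inE.
  apply: (separated_shatters (f := f)) => [p|B BA].
    by rewrite !inE => /andP[/asboolPn].
  have /implyP/(_ (fintype.subset_trans BA (finset.subsetDl _ _))) := sh B.
  move=> /existsP[S /andP[]]; rewrite inE => /asboolP sS /eqP SA.
  exists S => //; rewrite finset.setIDA SA.
  apply/setP => y; rewrite inE andbC; apply/andP/idP => [[]//|yB]; split => //.
  by have := fintype.subsetP BA y yB; rewrite inE => /andP[].
by rewrite cardsX leq_mul // card_small_subsets.
Qed.

End Separation.

(** * Probability of an unbalanced dichotomy *)

Section Bound.
Context {R : realType} {d : measure_display} {Om : measurableType d}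
  (m : {measure set Om -> \bar R}) (psi : nat -> Om -> R) (lam : nat -> R).
Hypothesis lam_gt0 : forall j, 0 < lam j.

Local Notation H := (Hspace m psi lam).

Definition unbalanced_event {n : nat} (kappa : R) {Om' : Type}
    (Z : 'I_n * bool -> Om' -> H) : set Om' :=
  [set w | exists2 S, unbalanced kappa S & separated S (fun p => Z p w)].

Context {d'} {Om' : measurableType d'} (Pr : probability Om' R) (mu : probability H R).

Lemma measurable_unbalanced_event {n : nat} (kappa : R) (Z : 'I_n * bool -> Om' -> H) :
  (forall p, measurable_fun setT (Z p)) -> measurable (unbalanced_event kappa Z).
Proof.
move=> mZ; have -> : unbalanced_event kappa Z =
  \bigcup_(S in [set S | unbalanced kappa S]) [set w | separated S (fun p => Z p w)].
  by apply/seteqP; split => w [S]; exists S.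
by apply: fin_bigcup_measurable => [|S _]; [exact: finite_finset|exact: measurable_separated].
Qed.

Lemma separated_swap {n : nat} (s : {ffun 'I_n -> bool}) (S : {set 'I_n * bool})
    (f : 'I_n * bool -> H) :
  separated (swap_set s S) f <-> separated S (f \o swap s).
Proof.
split => -[qt h]; exists qt => p /=.
  by have := h (swap s p); rewrite inE swapK.
by have := h (swap s p); rewrite inE /= swapK.
Qed.

Lemma sum_separated_tail_le {J : finType} (k : nat) (Z : J -> Om' -> H) :
  rectangle_law Pr mu Z ->
  \sum_(S : {set J}) fine (Pr [set w | separated S (fun p => Z p w)]) <=
  ((#|J| + 1) ^ k.+1)%:R * (1 + fine (mu (tail_set m psi lam k))) ^+ #|J|.
Proof.
move=> lawZ; have mT := measurable_tail_set (m := m) (psi := psi) lam_gt0 k.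
have hU U := rectangle_law_all U lawZ mT.
(* Expanding [(1 + q) ^ #|J|] over subsets [U] gives the terms [q ^ #|U|], the probabilities that
   all of [U] lies in the tail. *)
rewrite addrC -prodr_const bigA_distr /= mulr_sumr.
rewrite [leRHS](eq_bigr (fun U : {set J} => ((#|J| + 1) ^ k.+1)%:R *
  fine (Pr [set w | forall p, p \in U -> tail_set m psi lam k (Z p w)]))); last first.
  by move=> U _; rewrite (hU U).2 -prodr_const [in RHS]big_mkcond.
rewrite [leLHS](eq_bigr (fun S =>
  1 * fine (Pr [set w | separated S (fun p => Z p w)]))); last first.
  by move=> S _; rewrite mul1r.
rewrite [leRHS](eq_bigl xpredT); last by move=> U; rewrite inE.
apply: sum_measure_le => //.
- by move=> S; apply: measurable_separated; exact: lawZ.1.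
- by move=> U; exact: (hU U).1.
move=> w; apply: (le_trans _ (le_trans (sum_separated_le lam_gt0 k (fun p => Z p w)) _)).
  by apply: ler_sum => S _; rewrite mul1r !indicE.
rewrite mulr_sumr; by apply: ler_sum => U _; rewrite ler_wpM2l // !indicE.
Qed.

(** A union bound over unbalanced sets, then averaging over swaps, under which the law of the [2n]
    points is invariant, then the expected number of dichotomies. *)
Lemma unbalanced_event_le {n : nat} (kappa : R) (k : nat) (Z : 'I_n * bool -> Om' -> H) :
  0 <= kappa -> rectangle_law Pr mu Z ->
  fine (Pr (unbalanced_event kappa Z)) <= 2 * expR (- kappa / 8) *
    (((2 * n + 1) ^ k.+1)%:R * (1 + fine (mu (tail_set m psi lam k))) ^+ (2 * n)).
Proof.
move=> k0 lawZ; have mZ := lawZ.1.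
pose f (S : {set 'I_n * bool}) := fine (Pr [set w | separated S (fun p => Z p w)]).
pose A (S : {set 'I_n * bool}) :=
  if unbalanced kappa S then [set w | separated S (fun p => Z p w)] else set0.
apply: (@le_trans _ _ (\sum_(S | unbalanced kappa S) f S)).
  have -> : \sum_(S | unbalanced kappa S) f S = \sum_S 1 * fine (Pr (A S)).
    rewrite big_mkcond; apply: eq_bigr => S _; rewrite mul1r /A.
    by case: ifP => // _; rewrite measure0.
  (* A one-element index type presents the single event as a weighted sum. *)
  have -> : fine (Pr (unbalanced_event kappa Z)) =
      \sum_(i : unit) 1 * fine (Pr (unbalanced_event kappa Z)).
    by rewrite big_const card_unit /= addr0 mul1r.
  apply: sum_measure_le => // [_|S|w].
  - exact: measurable_unbalanced_event.
  - by rewrite /A; case: ifP => // _; exact: measurable_separated.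
  rewrite big_const card_unit /= addr0 mul1r indicE.
  have A0 S : 0 <= 1 * \1_(A S) w by rewrite mul1r.
  case: (boolP (w \in _)) => [/set_mem[S uS sS]|_]; last by apply: sumr_ge0.
  rewrite (bigD1 S) //= {1}/A uS indicE mem_set //= mul1r.
  by rewrite lerDl sumr_ge0.
apply: (le_trans (sum_unbalanced_le k0 _ _)).
- by move=> S; exact: fine_ge0.
- move=> s S; rewrite /f; congr fine.
  have bs : bijective (swap s) by exists (swap s); exact: swapK.
  rewrite -(rectangle_law_unique (rectangle_law_reindex bs lawZ) lawZ (separated_cylinder S)).
  by congr (Pr _); apply/seteqP; split => w;
    have [h1 h2] := separated_swap s S (fun p => Z p w).
rewrite ler_wpM2l ?mulr_ge0 ?expR_ge0 //.
have := sum_separated_tail_le k lawZ.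
by rewrite card_prod card_bool card_ord mulnC.
Qed.
End Bound.

(** * Chebyshev bound and relative deviations *)

(** The count has variance [n q (1 - q) <= n q]; keeping the factor [q] is what permits a relative
    deviation bound. *)
Lemma iid_chebyshev {d dT} {Om : measurableType d} {T : measurableType dT}
    {R : realType} {n : nat} (P : probability Om R) (mu : probability T R)
    (X : 'I_n -> Om -> T) (A : set T) (s : R) :
  0 <= s -> iid P X mu -> measurable A ->
  measurable [set w | s <= `|\sum_i \1_A (X i w) - n%:R * fine (mu A)|] /\
  s ^+ 2 * fine (P [set w | s <= `|\sum_i \1_A (X i w) - n%:R * fine (mu A)|]) <=
  n%:R * fine (mu A).
Proof.
move=> s0 iidX mA; have lawX := rectangle_law_iid iidX.
set q := fine (mu A); set E := [set w | _].
have q0 : 0 <= q by exact: fine_ge0.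
have mN : measurable_fun setT (fun w => `|\sum_i \1_A (X i w) - n%:R * q|).
  apply: measurableT_comp => //; apply: measurable_funB => //.
  apply: measurable_sum => i; apply: measurableT_comp; last exact: lawX.1.
  exact: measurable_indic.
have mE : measurable E.
  have -> : E = (fun w => `|\sum_i \1_A (X i w) - n%:R * q|) @^-1` `[s, +oo[.
    by apply/seteqP; split => w; rewrite /= in_itv /= andbT.
  by rewrite -[X in measurable X]setTI; apply: mN => //; exact: measurable_itv.
split => //.
have hU U := rectangle_law_all U lawX mA.
pose B (U : {set 'I_n}) := [set w | forall p, p \in U -> A (X p w)].
have BE (U : {set 'I_n}) w : \1_(B U) w = \prod_(i in U) \1_A (X i w) :> R.
  rewrite indicE; case: (boolP (w \in _)) => [/set_mem h|h].
    by rewrite big1 // => i iU; rewrite indicE mem_set //; exact: h.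
  have /existsNP[i /not_implyP[iU nA]] : ~ forall i, i \in U -> A (X i w).
    by move=> h'; move: h; rewrite mem_set.
  by rewrite (bigD1 i) //= indicE memNset ?mul0r.
(* [(N - nq)^2 + 2nqN = N^2 + (nq)^2] turns the variance computation into one
   between nonnegative combinations of indicators. *)
pose a (i : unit + 'I_n) : R := if i is inl _ then s ^+ 2 else 2 * (n%:R * q).
pose b (k : unit + 'I_n * 'I_n) : R := if k is inl _ then (n%:R * q) ^+ 2 else 1.
pose EA (i : unit + 'I_n) := if i is inr i then B [set i]%SET else E.
pose EB (k : unit + 'I_n * 'I_n) := if k is inr p then B [set p.1; p.2]%SET else setT.
have key : \sum_i a i * fine (P (EA i)) <= \sum_k b k * fine (P (EB k)).
  apply: sum_measure_le => //.
  - by case=> [u|u]; rewrite /a ?sqr_ge0 ?mulr_ge0.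
  - by case=> u; rewrite /b ?sqr_ge0.
  - by case=> [u //|i]; exact: (hU _).1.
  - by case=> [u //|p]; [exact: measurableT|exact: (hU _).1].
  move=> w; rewrite !big_sumType /= !big_const !card_unit /= !addr0.
  have -> : \sum_i 2 * (n%:R * q) * \1_(B [set i]%SET) w =
      2 * (n%:R * q) * \sum_i \1_A (X i w).
    by rewrite mulr_sumr; apply: eq_bigr => i _; rewrite BE big_set1.
  have -> : \sum_(p : 'I_n * 'I_n) 1 * \1_(B [set p.1; p.2]%SET) w =
      (\sum_i \1_A (X i w)) ^+ 2 :> R.
    rewrite expr2 big_distrlr /= pair_bigA /=; apply: eq_bigr => -[i j] _ /=.
    rewrite mul1r BE; have [->|ij] := eqVneq i j; last by rewrite big_setU1 ?inE //= big_set1.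
    by rewrite finset.setUid big_set1 !indicE; case: (_ \in _); rewrite ?mulr1 ?mulr0.
  rewrite indicT mulr1 indicE; set N := \sum_i _.
  case: (boolP (w \in E)) => [/set_mem|_]; rewrite ?mulr1 ?mulr0; last first.
    by have := sqr_ge0 (N - n%:R * q); nra.
  rewrite /E /= -/N => sN; have := real_normK (num_real (N - n%:R * q)).
  by move: sN; move: `|_| => z sz ez; nra.
move: key; rewrite !big_sumType /= !big_const !card_unit /= !addr0 probability_setT mulr1.
under eq_bigr do rewrite (hU _).2 cards1 expr1.
rewrite sumr_const card_ord.
have : \sum_(p : 'I_n * 'I_n) 1 * fine (P (B [set p.1; p.2]%SET)) <=
    n%:R * q + (n%:R * q) ^+ 2.
  (* Off-diagonal pairs have probability [q^2]; the [n] diagonal ones have [q], bounded by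
     [q + q^2]. *)
  rewrite [leRHS](_ : _ = \sum_(p : 'I_n * 'I_n) ((p.1 == p.2)%:R * q + q ^+ 2)).
    apply: ler_sum => -[i j] _ /=; rewrite mul1r (hU _).2 cards2.
    by case: eqVneq => _ /=; rewrite ?expr1 ?mul1r ?mul0r ?add0r // lerDl sqr_ge0.
  rewrite big_split /= sumr_const card_prod card_ord -[X in _ = _ + X]mulr_natl natrM exprMn expr2.
  congr (_ + _).
  rewrite -(pair_bigA _ (fun i j => (i == j)%:R * q)) /=.
  under eq_bigr => i _.
    rewrite (bigD1 i) //= eqxx mul1r big1 ?addr0; last first.
      by move=> j /negbTE; rewrite eq_sym => ->; rewrite mul0r.
    over.
  by rewrite sumr_const card_ord mulr_natl.
set G := \sum_(_ | _) _; set F := fine (P E).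
rewrite -[X in _ -> _ + X <= _ -> _]mulr_natl -/q; lra.
Qed.

(** Here [r^2] stands for the maximum of [F] and [G]. Since [|F - G| <= r^2], the deviation forces
    [e < r], hence [G + G' <= 3 r^2], while [|G' - G| >= e r / 2]; the constant 12 is [3 * 4]. *)
Lemma unbalanced_of_deviation (R : realType) (F G G' e r : R) :
  0 <= F <= r ^+ 2 -> 0 <= G <= r ^+ 2 -> 0 <= r -> 0 < e ->
  e * r < `|F - G| -> `|G' - F| <= e / 2 * r ->
  G != G' /\ e ^+ 2 / 12 * (G + G') <= (G' - G) ^+ 2.
Proof.
move=> /andP[F0 Fr] /andP[G0 Gr] r0 e0 dev close.
have r1 : e * r < r ^+ 2 by apply: (lt_le_trans dev); rewrite ler_norml; lra.
have rp : 0 < r by rewrite lt0r r0 andbT; apply: contraTneq r1 => ->; rewrite mulr0 expr0n ltxx.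
have er : e < r by move: r1; rewrite expr2 ltr_pM2r.
have low : e / 2 * r <= `|G' - G|.
  have : `|F - G| <= `|G' - G| + `|G' - F|.
    by rewrite (_ : F - G = (G' - G) - (G' - F)); [exact: ler_normB|ring].
  lra.
split.
  by apply: contraTneq low => ->; rewrite subrr normr0 -ltNge !mulr_gt0.
rewrite -(real_normK (num_real (G' - G))).
have : (e / 2 * r) ^+ 2 <= `|G' - G| ^+ 2.
  by rewrite ler_pXn2r ?nnegrE // mulr_ge0 //; lra.
apply: le_trans.
have GG : G + G' <= 3 * r ^+ 2.
  move: close; rewrite ler_norml => /andP[_ ?]; nra.
apply: (le_trans (ler_wpM2l _ GG)); first by rewrite divr_ge0 ?sqr_ge0.
lra.
Qed.

(** * The ghost sample *)

Section GhostSample.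
Context {R : realType} {d : measure_display} {Om : measurableType d}
  {m : {measure set Om -> \bar R}} {psi : nat -> Om -> R} {lam : nat -> R}.
Hypothesis lam_gt0 : forall j, 0 < lam j.

Local Notation H := (Hspace m psi lam).

(** For the trace [S] of the half-space, the imbalances sum to [n] times the difference of
    frequencies, and their squares to at most [n] times the sum, because [(a - b)^2 <= a + b] for
    values 0 and 1. *)
Lemma unbalanced_deviation {n : nat} {Om' : Type} (X : 'I_n -> Om' -> H)
    (th : H) (t kappa : R) (w w' : Om') : (0 < n)%N -> 0 <= kappa ->
  Fthn X th t w != Fthn X th t w' ->
  kappa / n%:R * (Fthn X th t w + Fthn X th t w') <=
    (Fthn X th t w' - Fthn X th t w) ^+ 2 ->
  unbalanced_event kappa (ghost X) (w, w').
Proof.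
move=> n0 k0 ne dev; have n0' : 0 < n%:R :> R by rewrite ltr0n.
pose S : {set 'I_n * bool} := finset (fun p => Hip m psi lam (ghost X p (w, w')) th <= t).
have [qt hqt] := rat_dichotomy lam_gt0 (fun p => ghost X p (w, w')) th t.
exists S; last first.
  exists qt => p; have [h1 h2] := hqt p; rewrite inE -ltNge; split.
    exact: h1.
  exact: h2.
pose a (v : Om') i : R := (Hip m psi lam (X i v) th <= t)%R%:R.
have FE v : \sum_i a v i = n%:R * Fthn X th t v.
  by rewrite /Fthn mulrCA divff ?mulr1 // lt0r_neq0.
have imbE i : imbalance S i = a w' i - a w i :> R by rewrite /imbalance !inE.
have sumE : \sum_i imbalance S i = n%:R * (Fthn X th t w' - Fthn X th t w) :> R.
  by under eq_bigr do rewrite imbE; rewrite sumrB !FE mulrBr.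
have sqle : \sum_i imbalance S i ^+ 2 <= n%:R * (Fthn X th t w + Fthn X th t w') :> R.
  rewrite mulrDr -!FE -big_split /=; apply: ler_sum => i _; rewrite imbE /a.
  by case: (Hip m psi lam (X i w') th <= t); case: (Hip m psi lam (X i w) th <= t);
    rewrite ?subrr ?subr0 ?sub0r ?sqrrN ?expr0n ?expr1n /=; lra.
have sq0 i : 0 <= (imbalance S i : R) ^+ 2 by exact: sqr_ge0.
apply/andP; split.
  rewrite lt_neqAle sumr_ge0 // andbT eq_sym; apply: contra ne.
  rewrite psumr_eq0 // => /allP h.
  have /eqP : \sum_i imbalance S i = 0 :> R.
    apply: big1 => i _; have := h i (mem_index_enum _).
    by rewrite /= sqrf_eq0 => /eqP.
  by rewrite sumE mulf_eq0 gt_eqF //= subr_eq0 eq_sym.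
rewrite sumE exprMn; apply: (le_trans (ler_wpM2l k0 sqle)).
apply: le_trans (ler_wpM2l (exprn_ge0 2 (ltW n0')) dev).
by rewrite le_eqVlt; apply/orP; left; apply/eqP; field; exact: lt0r_neq0.
Qed.

Lemma bad_event_ghost {d'} {Om' : measurableType d'} {n : nat} (P : probability Om' R)
    (mu : probability H R) (X : 'I_n -> Om' -> H) (eps : R) :
  (0 < n)%N -> iid P X mu -> 0 < eps -> 32 <= n%:R * eps ^+ 2 ->
  bad_event mu X eps `<=`
  [set w | ((1 / 2)%:E <=
    P (xsection (unbalanced_event (n%:R * eps ^+ 2 / 48) (ghost X)) w))%E].
Proof.
move=> n0 iidX eps0 neps w bad; have n0' : 0 < n%:R :> R by rewrite ltr0n.
set D := unbalanced_event _ _.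
have mD : measurable D.
  by apply: measurable_unbalanced_event => //; exact: (rectangle_law_ghost iidX).1.
(* The supremum need not be attained, so half of [eps] is given up to obtain an actual
   half-space. *)
have [th [t rat]] : exists th, exists t, eps / 2 < Defs.ratio mu X th t w.
  apply: contrapT => h.
  have : (eps%:E <= (eps / 2)%:E)%E.
    apply: (le_trans bad); apply: ge_ereal_sup => _ [[th t] _ <-].
    rewrite lee_fin leNgt; apply/negP => /= h'; apply: h; by exists th, t.
  by rewrite lee_fin; lra.
pose A : set H := [set x | Hip m psi lam x th <= t].
have mA : measurable A.
  have -> : A = (fun x : H => Hip m psi lam x th) @^-1` `]-oo, t].
    by apply/seteqP; split => x; rewrite /= in_itv.
  rewrite -[X in measurable X]setTI; apply: measurable_Hip => //.
have FnE v : Fthn X th t v = (\sum_i \1_A (X i v)) / n%:R.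
  congr (_ / _); apply: eq_bigr => i _; rewrite indicE.
  have -> // : (X i v \in A) = (Hip m psi lam (X i v) th <= t).
  by apply/idP/idP => [/set_mem|h]; [|exact: mem_set].
set F := Fth mu th t; set G := Fthn X th t w.
pose r := Num.sqrt (Num.max F G).
have F0 : 0 <= F by exact: fine_ge0.
have G0 : 0 <= G by rewrite /G FnE divr_ge0 // sumr_ge0.
have r2 : r ^+ 2 = Num.max F G by rewrite sqr_sqrtr // le_max F0.
have r0 : 0 <= r by exact: sqrtr_ge0.
(* Division by zero yields 0, so [r = 0] would make the ratio 0 and contradict [rat]. *)
have rp : 0 < r.
  rewrite lt0r r0 andbT; apply: contraTneq rat => e.
  by rewrite /Defs.ratio -/F -/G -/r e invr0 mulr0 -leNgt; lra.
have dev : eps / 2 * r < `|F - G|.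
  by move: rat; rewrite /Defs.ratio -/F -/G -/r ltr_pdivlMr.
have FG : (F <= r ^+ 2) && (G <= r ^+ 2) by rewrite r2 !le_max !lexx orbT.
have [Fr Gr] := andP FG.
(* Half the deviation [eps / 2 * r], on the scale of counts. With [n eps^2 >= 32], Chebyshev gives
   the ghost frequency probability at most 1/2 of missing [F] by this much. *)
pose s := n%:R * (eps / 2 / 2 * r).
have s0 : 0 <= s by rewrite !mulr_ge0 //; lra.
have [mE chb] := iid_chebyshev s0 iidX mA.
set E := [set w | _] in mE chb.
have [q Pq] : exists q, P E = q%:E.
  by exists (fine (P E)); rewrite fineK // fin_num_measure.
have q0 : 0 <= q by rewrite -lee_fin -Pq.
have qle : q <= 1 / 2.
  have : n%:R * r ^+ 2 * (n%:R * eps ^+ 2 / 16 * q) <= n%:R * r ^+ 2 * 1.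
    move: chb; rewrite Pq /= -/(Fth mu th t) -/F => chb.
    rewrite mulr1; apply: le_trans (le_trans chb _); last by rewrite ler_pM2l.
    by rewrite /s; lra.
  rewrite ler_pM2l ?mulr_gt0 ?exprn_gt0 // => h.
  have : 2 * q <= n%:R * eps ^+ 2 / 16 * q by rewrite ler_wpM2r //; lra.
  lra.
have PE' : ((1 / 2)%:E <= P (~` E))%E.
  by rewrite probability_setC // Pq -EFinB lee_fin; lra.
apply: (le_trans PE'); apply: le_measure; rewrite ?inE.
- exact: measurableC.
- exact: measurable_xsection.
move=> w' nE; rewrite /xsection /= inE.
have close : `|Fthn X th t w' - F| <= eps / 2 / 2 * r.
  move/negP: nE; rewrite -ltNge -/(Fth mu th t) -/F => /ltW.
  have -> : \sum_i \1_A (X i w') - n%:R * F = n%:R * (Fthn X th t w' - F) :> R.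
    by rewrite FnE; field; exact: lt0r_neq0.
  by rewrite normrM (ger0_norm (ltW n0')) ler_pM2l.
have [ne sq] := @unbalanced_of_deviation R F G (Fthn X th t w') (eps / 2) r
  (introT andP (conj F0 Fr)) (introT andP (conj G0 Gr)) r0 ltac:(lra) dev close.
apply: (unbalanced_deviation (th := th) (t := t)) => //.
  by rewrite divr_ge0 // mulr_ge0 // ?sqr_ge0 // ltW.
have -> // : n%:R * eps ^+ 2 / 48 / n%:R = (eps / 2) ^+ 2 / 12 :> R.
by field; exact: lt0r_neq0.
Qed.

(** Markov's inequality for the section probability, whose integral is the product measure of
    [D]. *)
Lemma ghost_markov {d'} {Om' : measurableType d'} (P : probability Om' R)
    (D : set (Om' * Om')) : measurable D ->
  measurable [set w | ((1 / 2)%:E <= P (xsection D w))%E] /\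
  (P [set w | ((1 / 2)%:E <= P (xsection D w))%E] <=
     (2 * fine ((P \x P) D))%:E)%E.
Proof.
move=> mD; set B := [set w | _].
have mx : measurable_fun setT (P \o xsection D) by exact: measurable_fun_xsection.
have mB : measurable B.
  by have := emeasurable_fun_c_infty measurableT mx (1 / 2)%:E; rewrite setTI.
split => //.
have : ((1 / 2)%:E * P B <= (P \x P) D)%E.
  rewrite -[in leLHS](setIT B) -integral_indic // -ge0_integralZl_EFin //; last first.
    by apply/measurable_EFinP; exact: measurable_indic.
  apply: ge0_le_integral => //.
  - apply/measurable_EFinP; apply: measurable_funM; first exact: measurable_cst.
    exact: measurable_indic.
  - move=> w _; rewrite -EFinM indicE; case: (boolP (w \in B)) => [/set_mem|_].
      by rewrite mulr1.
    by rewrite mulr0.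
rewrite -(fineK (fin_num_measure P _ mB)).
rewrite -[X in (_ <= X)%E](fineK (fin_num_measure ((P \x P)%E : probability _ R) _ mD)) -EFinM !lee_fin.
lra.
Qed.
End GhostSample.

(** * Numerical estimates *)

Lemma ln_ge23 (R : realType) (x : R) : 3 <= x -> 2 / 3 <= ln x.
Proof.
move=> x3; rewrite -[leLHS]expRK ler_ln ?posrE ?expR_gt0 //; last by lra.
apply: le_trans x3; rewrite -[leLHS]invrK -expRN.
have : 1 / 3 <= expR (- (2 / 3)) :> R by apply: le_trans (expR_ge1Dx _); lra.
by rewrite -lef_pV2 ?posrE ?expR_gt0 //; lra.
Qed.

(** Take [k] one above the integer part of [n^(1/gam)]: rounding strictly up brings [k^(-gam)] below
    [1/n]. *)
Lemma dimension_choice (R : realType) (gam : R) (n : nat) : 0 < gam -> (0 < n)%N ->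
  exists k : nat, [/\ (0 < k)%N, k%:R <= n%:R `^ gam^-1 + 1 &
    (k%:R : R) `^ (- gam) <= n%:R^-1].
Proof.
move=> g0 n0; have n0' : 0 < n%:R :> R by rewrite ltr0n.
set a := n%:R `^ gam^-1; have a0 : 0 <= a by exact: powR_ge0.
exists (Num.truncn a).+1; split => //.
  by rewrite -addn1 natrD lerD2r truncn_le.
rewrite powRN lef_pV2 ?posrE ?powR_gt0 ?ltr0n //.
have -> : n%:R = a `^ gam by rewrite /a -powRrM mulVf ?lt0r_neq0 // powRr1 // ltW.
by rewrite ge0_ler_powR ?nnegrE // ltW // truncnS_gt.
Qed.

(** Bound 4 by [expR 2], [(1 + q)^(2n)] by [expR (2 C)] and [(k + 1) L] by [3 a L]. The rest,
    [2 + 2 C], is at most [(3 + 3 C) L a] since [L >= 2/3]. *)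
Lemma exponent_bound (R : realType) (C a L K E q : R) (n k : nat) :
  0 < C -> (0 < n)%N -> 2 / 3 <= L -> 1 <= a -> k%:R <= a + 1 ->
  L = ln (2 * n%:R + 1) -> 0 <= q -> n%:R * q <= C ->
  2 * (2 * expR (- E) * (((2 * n + 1) ^ k.+1)%:R * (1 + q) ^+ (2 * n))) <=
  expR ((6 + 3 * C) * L * a - E).
Proof.
move=> C0 n0 L23 a1 ka LE q0 nq.
have hq : (1 + q) ^+ (2 * n) <= expR (2 * C).
  apply: (@le_trans _ _ (expR q ^+ (2 * n))).
    by apply: lerXn2r; rewrite ?nnegrE ?expR_ge0 ?addr_ge0 ?expR_ge1Dx.
  by rewrite -expRM_natl ler_expR natrM; lra.
have hk : ((2 * n + 1) ^ k.+1)%:R = expR (k.+1%:R * L) :> R.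
  rewrite LE expRM_natl lnK; first by rewrite natrX natrD natrM.
  by rewrite posrE ltr_wpDl // mulr_ge0.
have h2 : 2 <= expR 1 :> R by apply: le_trans (expR_ge1Dx _); lra.
have -> : 2 * (2 * expR (- E) * (((2 * n + 1) ^ k.+1)%:R * (1 + q) ^+ (2 * n))) =
  (2 * 2) * (expR (- E) * (expR (k.+1%:R * L) * (1 + q) ^+ (2 * n))) by rewrite hk; ring.
apply: (@le_trans _ _ ((expR 1 * expR 1) * (expR (- E) * (expR (k.+1%:R * L) * expR (2 * C))))).
  apply: ler_pM => //; rewrite ?mulr_ge0 ?expR_ge0 ?exprn_ge0 ?addr_ge0 //.
    by apply: ler_pM.
  by rewrite !ler_wpM2l ?expR_ge0.
rewrite -!expRD ler_expR -natr1.
have : (k%:R + 1) * L <= 3 * a * L by rewrite ler_wpM2r; lra.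
have : (3 + 3 * C) * (2 / 3) <= (3 + 3 * C) * (L * a).
  by rewrite ler_wpM2l //; nra.
nra.
Qed.

(** * The deviation inequality and its constants *)

Unset Implicit Arguments.
Set Strict Implicit.

Theorem theorem3p11 (R : realType) :
  exists c : R, 0 < c /\
  forall (gam C : R), 1 < gam -> 0 < C ->
  exists C' : R, 0 < C' /\
  forall (d : measure_display) (Om : measurableType d)
    (m : {measure set Om -> \bar R}) (psi : nat -> Om -> R) (lam : nat -> R),
    orthonormal_basis m psi ->
    (forall j, 0 < lam j) -> nonincreasing_seq lam -> lam @ \oo --> 0 ->
  forall mu : probability (Hspace m psi lam) R,
    (forall k : nat, (1 <= k)%N ->
       (mu (tail_set m psi lam k) <= (C * k%:R `^ (- gam))%:E)%E) ->
  forall (dP : measure_display) (Om' : measurableType dP)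
    (P : probability Om' R) (n : nat) (X : 'I_n -> Om' -> Hspace m psi lam),
    (0 < n)%N -> iid P X mu ->
  forall eps : R, 0 < eps ->
    exists B : set Om', measurable B /\ bad_event mu X eps `<=` B /\
      (P B <= (expR (C' * ln (2 * n%:R + 1) * n%:R `^ gam^-1
                     - c * n%:R * eps ^+ 2 / 64))%:E)%E.
Proof.
(* With [kappa = n eps^2 / 48], the swap exponent [kappa / 8] is [n eps^2 / 384], that is [1/6] of
   [n eps^2 / 64]. *)
exists (1 / 6); split; first by lra.
move=> gam C gam1 C0; exists (6 + 3 * C); split; first by lra.
move=> d Om m psi lam _ lam_gt0 _ _ mu tail_mu dP Om' P n X n0 iidX eps eps0.
have n1 : 1 <= n%:R :> R by rewrite ler1n.
set L := ln _; set a := n%:R `^ _.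
have L23 : 2 / 3 <= L by apply: ln_ge23; lra.
have a1 : 1 <= a by rewrite /a -[leLHS](powRr0 n%:R) ler_powR // invr_ge0; lra.
have expE : 1 / 6 * n%:R * eps ^+ 2 / 64 = n%:R * eps ^+ 2 / 48 / 8 by field.
(* Below 32 the subtracted term is under [1/12] and the other at least 4, so the claimed bound
   exceeds 1. *)
have [neps|neps] := ltP (n%:R * eps ^+ 2) 32.
  exists setT; split; [exact: measurableT|split=> //].
  rewrite probability_setT lee_fin -[leLHS]expR0 ler_expR expE subr_ge0.
  have : 6 * (2 / 3) <= (6 + 3 * C) * L by apply: ler_pM; lra.
  have : (6 + 3 * C) * L <= (6 + 3 * C) * L * a by rewrite ler_peMr // mulr_ge0; lra.
  lra.
have [k [k0 ka kn]] : exists k : nat, [/\ (0 < k)%N, k%:R <= a + 1 &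
    (k%:R : R) `^ (- gam) <= n%:R^-1] by apply: dimension_choice => //; lra.
pose kappa := n%:R * eps ^+ 2 / 48.
have kappa0 : 0 <= kappa by rewrite divr_ge0 // mulr_ge0 ?sqr_ge0.
have lawZ := rectangle_law_ghost iidX.
have mD := measurable_unbalanced_event kappa lawZ.1.
have [mB PB] := ghost_markov P mD.
(* This set is measurable and covers the bad event, a supremum over uncountably many half-spaces. *)
exists [set w | ((1 / 2)%:E <= P (xsection (unbalanced_event kappa (ghost X)) w))%E].
split => //; split; first exact: bad_event_ghost.
apply: (le_trans PB); rewrite lee_fin expE -/kappa.
set q := fine (mu (tail_set m psi lam k)).
have q0 : 0 <= q by exact: fine_ge0.
have nq : n%:R * q <= C.
  have mT := measurable_tail_set (m := m) (psi := psi) lam_gt0 k.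
  have := tail_mu k k0; rewrite -(fineK (fin_num_measure mu _ mT)) lee_fin -/q => qk.
  have : q <= C * n%:R^-1 by apply: (le_trans qk); rewrite ler_wpM2l // ltW.
  by rewrite -ler_pdivlMl 1?mulrC //; lra.
have := unbalanced_event_le lam_gt0 k kappa0 lawZ; rewrite -/q => hD.
apply: (le_trans (ler_wpM2l _ hD)) => //.
rewrite mulNr; exact: exponent_bound.
Qed.
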